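(* Let $K$ be a field with $\operatorname{char}K\neq 2$ and let $k\geq 1$. Let $F$ be one of the algebras $E_{2k}\otimes E_{2k}$, $E_{2k+1}\otimes E_{2k+1}$, $E_{2k}\otimes E_{2k+1}$, $E_{2k+1}\otimes E_{2k}$. Then $F$ satisfies the identity $[x_1,\dots,x_{2k+2}]=0$. Furthermore, $F$ does not satisfy the identity $[x_1,\dots,x_{2k+1}]=0$.
   Context: $E_r$ ($r\ge 2$) denotes the (unital) Grassmann (exterior) algebra over an $r$-dimensional $K$-vector space. $\otimes=\otimes_K$ is the ordinary (ungraded) tensor product of algebras, with $(a\otimes b)(c\otimes d)=ac\otimes bd$. Long commutators are left-normed: $[u_1,u_2]=u_1u_2-u_2u_1$ and $[u_1,\dots,u_{m+1}]=[[u_1,\dots,u_m],u_{m+1}]$ for $m\ge 2$. An algebra satisfies an identity if the identity holds for all substitutions of algebra elements for the variables. *)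

(* Defs.v *)
From HB Require Import structures.
From mathcomp Require Import all_boot all_order all_algebra all_field.

Set Implicit Arguments.
Unset Strict Implicit.
Unset Printing Implicit Defensive.

Import GRing.Theory VectorInternalTheory.
Local Open Scope ring_scope.

Definition commutator (R : pzRingType) (a b : R) : R := a * b - b * a.

(* [lcomm [:: u1; ...; um]] is [u1, ..., um], i.e. [[u1, ..., u(m-1)], um];
   the value 0 on the empty sequence is a dummy. *)
Definition lcomm (R : pzRingType) (s : seq R) : R :=
  if s is u :: s' then foldl (@commutator R) u s' else 0.

Definition sat_lcomm (R : pzRingType) (m : nat) : Prop :=
  forall u : m.-tuple R, lcomm u = 0.

(* The Grassmann algebra on r generators: the space has the basis e_A, A a set
   of indices, where e_A stands for the product of the generators e_i, i in A,
   in increasing order.  Hence e_A e_B is 0 if A and B meet, and is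
   +/- e_(A u B) otherwise, the sign being that of the permutation sorting the
   concatenation of A and B. *)

(* An alias, because {ffun _ -> _} already has the pointwise product. *)
Definition grassmann (K : fieldType) (r : nat) : Type :=
  {ffun {set 'I_r} -> K^o}.

Section Grassmann.
Variables (K : fieldType) (r : nat).
Local Notation E := (grassmann K r).
Implicit Types (A B C : {set 'I_r}) (x y z : E).

HB.instance Definition _ := Vector.copy E {ffun {set 'I_r} -> K^o}.

Definition inversions A B : nat := (\sum_(i in A) \sum_(j in B) (j < i))%N.

Definition gcoef A B : K :=
  if [disjoint A & B] then (-1) ^+ inversions A B else 0.

Definition gbasis A : E := [ffun B => (A == B)%:R].

Definition gmul x y : E :=
  \sum_A \sum_B (x A * y B * gcoef A B) *: gbasis (A :|: B).

Lemma gbasis_sum x : x = \sum_A x A *: gbasis A.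
Proof.
apply/ffunP=> B; rewrite sum_ffunE (bigD1 B) //= !ffunE eqxx.
rewrite big1 ?addr0 => [|C neCB]; first by rewrite [RHS]mulr1.
by rewrite !ffunE (negPf neCB) scaler0.
Qed.

Lemma gmul_is_linear x : linear (gmul x).
Proof.
move=> a y z; rewrite /gmul scaler_sumr -big_split; apply: eq_bigr => A _ /=.
rewrite scaler_sumr -big_split; apply: eq_bigr => B _ /=.
rewrite !ffunE scalerA -scalerDl; congr (_ *: _).
by rewrite mulrDr mulrDl [a *: _]/(_ * _) mulrCA !mulrA.
Qed.
HB.instance Definition _ x := GRing.isLinear.Build K E E _ (gmul x)
  (gmul_is_linear x).

Definition gmulr y x : E := gmul x y.
Lemma gmulr_is_linear y : linear (gmulr y).
Proof.
move=> a x z; rewrite /gmulr /gmul scaler_sumr -big_split.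
apply: eq_bigr => A _ /=.
rewrite scaler_sumr -big_split; apply: eq_bigr => B _ /=.
rewrite !ffunE scalerA -scalerDl; congr (_ *: _).
by rewrite !mulrDl [a *: _]/(_ * _) !mulrA.
Qed.
HB.instance Definition _ y := GRing.isLinear.Build K E E _ (gmulr y)
  (gmulr_is_linear y).

Lemma gmul_basis A B :
  gmul (gbasis A) (gbasis B) = gcoef A B *: gbasis (A :|: B).
Proof.
rewrite /gmul (bigD1 A) //= (bigD1 B) //= !ffunE !eqxx !mul1r.
rewrite !big1 ?addr0 // => [C neCA|C neCB].
  apply: big1 => D _.
  by rewrite !ffunE [A == C]eq_sym (negPf neCA) !mul0r scale0r.
by rewrite !ffunE [B == C]eq_sym (negPf neCB) mulr0 mul0r scale0r.
Qed.

Lemma glin_ext (f g : {linear E -> E}) :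
  (forall A, f (gbasis A) = g (gbasis A)) -> f =1 g.
Proof.
move=> fg x; rewrite [x]gbasis_sum !linear_sum; apply: eq_bigr => A _.
by rewrite !linearZ /= fg.
Qed.

Lemma inversionsUl A B C : [disjoint A & B] ->
  inversions (A :|: B) C = (inversions A C + inversions B C)%N.
Proof.
move=> dAB; rewrite /inversions -bigU //; apply: eq_bigl => i.
by rewrite !inE.
Qed.

Lemma inversionsUr A B C : [disjoint B & C] ->
  inversions A (B :|: C) = (inversions A B + inversions A C)%N.
Proof.
move=> dBC; rewrite /inversions -big_split; apply: eq_bigr => i _ /=.
by rewrite -bigU //; apply: eq_bigl => j; rewrite !inE.
Qed.

Lemma gcoefA A B C :
  gcoef A B * gcoef (A :|: B) C = gcoef B C * gcoef A (B :|: C).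
Proof.
have dU : [disjoint A :|: B & C] = [disjoint A & C] && [disjoint B & C].
  by rewrite -!setI_eq0 setIUl setU_eq0.
have dU' : [disjoint A & B :|: C] = [disjoint A & B] && [disjoint A & C].
  by rewrite -!setI_eq0 setIUr setU_eq0.
rewrite /gcoef dU dU'.
case: (boolP [disjoint A & B]) => dAB; last by rewrite mul0r mulr0.
case: (boolP [disjoint B & C]) => dBC; last by rewrite andbF mul0r mulr0.
rewrite andbT /=; case: ifP => dAC; last by rewrite !mulr0.
rewrite -!exprD inversionsUl // inversionsUr //.
by congr (_ ^+ _); rewrite addnA [RHS]addnC.
Qed.

Lemma gmulA : associative gmul.
Proof.
move=> x y z.
pose f1 := [the {linear E -> E} of gmulr (gmul y z)].
pose g1 := [the {linear E -> E} of gmulr z \o gmulr y].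
apply: (glin_ext (f := f1) (g := g1)) => A; rewrite /f1 /g1 /= /gmulr.
pose f2 := [the {linear E -> E} of gmul (gbasis A) \o gmulr z].
pose g2 := [the {linear E -> E} of gmulr z \o gmul (gbasis A)].
apply: (glin_ext (f := f2) (g := g2) _ y) => B; rewrite /f2 /g2 /= /gmulr.
pose f3 := [the {linear E -> E} of gmul (gbasis A) \o gmul (gbasis B)].
pose g3 := [the {linear E -> E} of gmul (gmul (gbasis A) (gbasis B))].
apply: (glin_ext (f := f3) (g := g3) _ z) => C; rewrite /f3 /g3 /=.
rewrite !gmul_basis linearZ /= gmul_basis.
rewrite -[RHS]/(gmulr (gbasis C) _) [gmulr _ _]linearZ /= /gmulr gmul_basis.
by rewrite !scalerA gcoefA setUA.
Qed.

Lemma gcoef0l A : gcoef set0 A = 1.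
Proof. by rewrite /gcoef -setI_eq0 set0I eqxx /inversions big_set0. Qed.

Lemma gcoef0r A : gcoef A set0 = 1.
Proof.
rewrite /gcoef -setI_eq0 setI0 eqxx /inversions big1 // => i _.
by rewrite big_set0.
Qed.

Lemma gmul1l : left_id (gbasis set0) gmul.
Proof.
move=> x; apply: (glin_ext (f := [the {linear E -> E} of gmul (gbasis set0)])
  (g := [the {linear E -> E} of idfun])) => A /=.
by rewrite gmul_basis gcoef0l scale1r set0U.
Qed.

Lemma gmul1r : right_id (gbasis set0) gmul.
Proof.
move=> x; apply: (glin_ext (f := [the {linear E -> E} of gmulr (gbasis set0)])
  (g := [the {linear E -> E} of idfun])) => A /=.
by rewrite /gmulr gmul_basis gcoef0r scale1r setU0.
Qed.

Lemma gmulDl : left_distributive gmul +%R.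
Proof. by move=> x y z; exact: (linearD (gmulr z)). Qed.

Lemma gmulDr : right_distributive gmul +%R.
Proof. by move=> x y z; rewrite linearD. Qed.

Lemma gone_neq0 : gbasis set0 != 0.
Proof.
apply/eqP=> /ffunP/(_ set0); rewrite !ffunE eqxx => /eqP.
by rewrite oner_eq0.
Qed.

HB.instance Definition _ := GRing.Zmodule_isNzRing.Build E
  gmulA gmul1l gmul1r gmulDl gmulDr gone_neq0.

Lemma gscaleAl (a : K) x y : a *: (x * y) = (a *: x) * y.
Proof. exact/esym/(linearZ_LR [the {linear E -> E} of gmulr y]). Qed.

Lemma gscaleAr (a : K) x y : a *: (x * y) = x * (a *: y).
Proof. exact/esym/(linearZ_LR [the {linear E -> E} of gmul x]). Qed.

HB.instance Definition _ := GRing.Lmodule_isLalgebra.Build K E gscaleAl.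
HB.instance Definition _ := GRing.Lalgebra_isAlgebra.Build K E gscaleAr.
HB.instance Definition _ := Algebra_isFalgebra.Build K E.

Definition ggen (i : 'I_r) : E := gbasis [set i].

Lemma gbasisM A B : gbasis A * gbasis B = gcoef A B *: gbasis (A :|: B).
Proof. exact: gmul_basis. Qed.

Lemma gbasis0 : gbasis set0 = 1. Proof. by []. Qed.

Lemma ggen_sqr i : ggen i * ggen i = 0.
Proof.
by rewrite gbasisM /gcoef -setI_eq0 setIid -cards_eq0 cards1 scale0r.
Qed.

Lemma ggen_anticomm i j : ggen i * ggen j = - (ggen j * ggen i).
Proof.
have [->|neij] := eqVneq i j; first by rewrite ggen_sqr oppr0.
rewrite !gbasisM setUC -scaleNr; congr (_ *: _).
rewrite /gcoef !disjoints1 !inE [j == i]eq_sym neij /inversions !big_set1.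
by case: ltngtP neij => [||/val_inj->]; rewrite ?expr0 ?expr1 ?opprK ?eqxx.
Qed.

Lemma gbasis_prod A : gbasis A = \prod_(i <- enum A) ggen i.
Proof.
have: sorted (fun i j : 'I_r => (i < j)%N) (enum A).
  rewrite /enum_mem -enumT; apply: sorted_filter => [x y z|].
    exact: ltn_trans.
  rewrite -[sorted _ _](sorted_map (f := val) (e' := ltn)).
  by rewrite val_enum_ord iota_ltn_sorted.
move=> sA; have {1}->: A = [set i in enum A].
  by apply/setP=> i; rewrite inE mem_enum.
elim: (enum A) sA => [|i s IHs] sorted_s.
  by rewrite big_nil -gbasis0; congr gbasis; apply/setP=> j; rewrite !inE.
rewrite big_cons -IHs ?(path_sorted sorted_s) // gbasisM.
have lt_is j : j \in s -> (i < j)%N.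
  have: all (fun j : 'I_r => (i < j)%N) s.
    by apply: order_path_min sorted_s => x y z; apply: ltn_trans.
  by move/allP; apply.
have notin : i \notin s by apply/negP=> /lt_is; rewrite ltnn.
rewrite /gcoef disjoints1 inE notin /inversions big_set1 big1 => [|j].
  rewrite expr0 scale1r; congr gbasis.
  by apply/setP=> j; rewrite !inE.
by rewrite inE => /lt_is/ltnW; rewrite leqNgt => /negPf->.
Qed.

End Grassmann.

(* The ungraded tensor product of finite-dimensional algebras.  An element is
   represented by the matrix of its coordinates on the tensor products of the
   vectors of fixed bases of A and B; [tensM] and [tens_universal] below show
   that this representation is the expected one. *)

Definition tensor (K : fieldType) (A B : falgType K) : Type :=
  'M[K]_(dim A, dim B).

Section Tensor.
Variables (K : fieldType) (A B : falgType K).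
Local Notation T := (tensor A B).
Implicit Types (a c : A) (b d : B) (x y z : T).

HB.instance Definition _ := Vector.copy T 'M[K]_(dim A, dim B).

Definition tens a b : T := (v2r a)^T *m v2r b.

Definition tbase (V : vectType K) (i : 'I_(dim V)) : V := r2v (delta_mx 0 i).

(* The bilinear extension of (a (x) b) (c (x) d) = ac (x) bd. *)
Definition tmul x y : T :=
  \sum_i \sum_j \sum_k \sum_l (x i j * y k l) *:
    tens (tbase i * tbase k) (tbase j * tbase l).

Lemma tens_is_linear a : linear (tens a).
Proof. by move=> k b d; rewrite /tens linearP mulmxDr -scalemxAr. Qed.
HB.instance Definition _ a := GRing.isLinear.Build K B T _ (tens a)
  (tens_is_linear a).

Definition tensr b a : T := tens a b.
Lemma tensr_is_linear b : linear (tensr b).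
Proof.
by move=> k a c; rewrite /tensr /tens !linearP /= mulmxDl -scalemxAl.
Qed.
HB.instance Definition _ b := GRing.isLinear.Build K A T _ (tensr b)
  (tensr_is_linear b).

Lemma tbase_sum (V : vectType K) (v : V) : v = \sum_i v2r v 0 i *: tbase i.
Proof.
apply: v2r_inj; rewrite {1}[v2r v]row_sum_delta linear_sum.
by apply: eq_bigr => i _; rewrite linearZ /= r2vK.
Qed.

Lemma tens_base i j : tens (tbase i) (tbase j) = delta_mx i j.
Proof. by rewrite /tens !r2vK trmx_delta mul_delta_mx. Qed.

Lemma tens_sum x : x = \sum_i \sum_j x i j *: tens (tbase i) (tbase j).
Proof.
rewrite {1}[x]matrix_sum_delta.
by apply: eq_bigr => i _; apply: eq_bigr => j _; rewrite tens_base.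
Qed.

Lemma tlin_ext (W : lmodType K) (f g : {linear T -> W}) :
  (forall a b, f (tens a b) = g (tens a b)) -> f =1 g.
Proof.
move=> fg x; rewrite [x]tens_sum !linear_sum; apply: eq_bigr => i _.
by rewrite !linear_sum; apply: eq_bigr => j _; rewrite !linearZ /= fg.
Qed.

Lemma tmul_is_linear x : linear (tmul x).
Proof.
move=> a y z; rewrite /tmul.
do 4! [rewrite scaler_sumr -big_split; apply: eq_bigr => ? _ /=].
by rewrite !mxE scalerA -scalerDl mulrDr mulrCA.
Qed.
HB.instance Definition _ x := GRing.isLinear.Build K T T _ (tmul x)
  (tmul_is_linear x).

Definition tmulr y x : T := tmul x y.
Lemma tmulr_is_linear y : linear (tmulr y).
Proof.
move=> a x z; rewrite /tmulr /tmul.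
do 4! [rewrite scaler_sumr -big_split; apply: eq_bigr => ? _ /=].
by rewrite !mxE scalerA -scalerDl mulrDl mulrA.
Qed.
HB.instance Definition _ y := GRing.isLinear.Build K T T _ (tmulr y)
  (tmulr_is_linear y).

Lemma tens_suml I (t : seq I) (F : I -> A) b :
  tens (\sum_(i <- t) F i) b = \sum_(i <- t) tens (F i) b.
Proof. exact: (linear_sum [the {linear A -> T} of tensr b]). Qed.

Lemma tens_sumr I (t : seq I) a (F : I -> B) :
  tens a (\sum_(i <- t) F i) = \sum_(i <- t) tens a (F i).
Proof. exact: (linear_sum [the {linear B -> T} of tens a]). Qed.

Lemma tensZl (k : K) a b : tens (k *: a) b = k *: tens a b.
Proof. exact: (linearZ_LR [the {linear A -> T} of tensr b]). Qed.

Lemma tensZr (k : K) a b : tens a (k *: b) = k *: tens a b.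
Proof. exact: (linearZ_LR [the {linear B -> T} of tens a]). Qed.

Lemma tmul_tens a b c d : tmul (tens a b) (tens c d) = tens (a * c) (b * d).
Proof.
rewrite [in RHS](tbase_sum a) [in RHS](tbase_sum b).
rewrite [in RHS](tbase_sum c) [in RHS](tbase_sum d) /tmul.
rewrite mulr_suml tens_suml; apply: eq_bigr => i _.
rewrite mulr_suml tens_sumr; apply: eq_bigr => j _.
rewrite mulr_sumr tens_suml; apply: eq_bigr => k _.
rewrite mulr_sumr tens_sumr; apply: eq_bigr => l _.
rewrite -!scalerAl -!scalerAr !tensZl !tensZr !scalerA; congr (_ *: _).
rewrite /tens !mxE !big_ord1 !mxE.
by rewrite [LHS]mulrACA [LHS]mulrA.
Qed.

Lemma tmulA : associative tmul.
Proof.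
move=> x y z.
apply: (tlin_ext (f := [the {linear T -> T} of tmulr (tmul y z)])
  (g := [the {linear T -> T} of tmulr z \o tmulr y])) => a b /=; rewrite /tmulr.
apply: (tlin_ext (f := [the {linear T -> T} of tmul (tens a b) \o tmulr z])
  (g := [the {linear T -> T} of tmulr z \o tmul (tens a b)]) _ y) => c d /=.
rewrite /tmulr.
apply: (tlin_ext
  (f := [the {linear T -> T} of tmul (tens a b) \o tmul (tens c d)])
  (g := [the {linear T -> T} of tmul (tmul (tens a b) (tens c d))]) _ z).
by move=> e f /=; rewrite !tmul_tens !mulrA.
Qed.

Lemma tmul1l : left_id (tens 1 1) tmul.
Proof.
move=> x; apply: (tlin_ext (f := [the {linear T -> T} of tmul (tens 1 1)])
  (g := [the {linear T -> T} of idfun])) => a b /=.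
by rewrite tmul_tens !mul1r.
Qed.

Lemma tmul1r : right_id (tens 1 1) tmul.
Proof.
move=> x; apply: (tlin_ext (f := [the {linear T -> T} of tmulr (tens 1 1)])
  (g := [the {linear T -> T} of idfun])) => a b /=.
by rewrite /tmulr tmul_tens !mulr1.
Qed.

Lemma tmulDl : left_distributive tmul +%R.
Proof. by move=> x y z; exact: (linearD (tmulr z)). Qed.

Lemma tmulDr : right_distributive tmul +%R.
Proof. by move=> x y z; rewrite linearD. Qed.

Lemma tens_eq0 a b : (tens a b == 0) = (a == 0) || (b == 0).
Proof.
apply/idP/idP => [/eqP ab0 | /orP[]/eqP->]; last 2 first.
- by rewrite -(scale0r 0) tensZl scale0r.
- by rewrite linear0.
have [//|a_neq0 /=] := eqVneq a 0.
have [i ai_neq0] : exists i, v2r a 0 i != 0.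
  apply/rV0Pn; apply: contra_neq a_neq0 => a0.
  by apply: v2r_inj; rewrite a0 linear0.
apply/eqP/v2r_inj/rowP=> j; rewrite linear0 mxE.
move/matrixP/(_ i j)/eqP: ab0; rewrite !mxE big_ord1 !mxE mulf_eq0.
by rewrite (negPf ai_neq0) => /eqP.
Qed.

Lemma tone_neq0 : tens 1 1 != 0.
Proof. by rewrite tens_eq0 !oner_eq0. Qed.

HB.instance Definition _ := GRing.Zmodule_isNzRing.Build T
  tmulA tmul1l tmul1r tmulDl tmulDr tone_neq0.

Lemma tscaleAl (k : K) x y : k *: (x * y) = (k *: x) * y.
Proof. exact/esym/(linearZ_LR [the {linear T -> T} of tmulr y]). Qed.

Lemma tscaleAr (k : K) x y : k *: (x * y) = x * (k *: y).
Proof. exact/esym/(linearZ_LR [the {linear T -> T} of tmul x]). Qed.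

HB.instance Definition _ := GRing.Lmodule_isLalgebra.Build K T tscaleAl.
HB.instance Definition _ := GRing.Lalgebra_isAlgebra.Build K T tscaleAr.
HB.instance Definition _ := Algebra_isFalgebra.Build K T.

Lemma tens1 : tens 1 1 = 1. Proof. by []. Qed.

Lemma tensM a b c d : tens a b * tens c d = tens (a * c) (b * d).
Proof. exact: tmul_tens. Qed.

Lemma tens_universal (W : lmodType K) (f : A -> B -> W) :
    (forall a, linear (f a)) -> (forall b, linear (f^~ b)) ->
  exists2 g : {linear T -> W}, (forall a b, g (tens a b) = f a b) &
    forall g' : {linear T -> W}, (forall a b, g' (tens a b) = f a b) -> g' =1 g.
Proof.
move=> f_linr f_linl.
pose g x := \sum_i \sum_j x i j *: f (tbase i) (tbase j).
have g_lin : linear g.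
  move=> k x y; rewrite /g.
  do 2! [rewrite scaler_sumr -big_split; apply: eq_bigr => ? _ /=].
  by rewrite !mxE scalerDl scalerA.
pose gL := HB.pack_for {linear T -> W} g (GRing.isLinear.Build K T W _ g g_lin).
have gE a b : gL (tens a b) = f a b.
  pose frL c := HB.pack_for {linear B -> W} (f c)
    (GRing.isLinear.Build K B W _ (f c) (f_linr c)).
  pose flL d := HB.pack_for {linear A -> W} (f^~ d)
    (GRing.isLinear.Build K A W _ (f^~ d) (f_linl d)).
  rewrite [in RHS](tbase_sum a) -[RHS]/(flL b _) linear_sum.
  apply: eq_bigr => i _; rewrite linearZ -[flL b _]/(frL (tbase i) b).
  rewrite [in RHS](tbase_sum b) linear_sum /= scaler_sumr.
  apply: eq_bigr => j _; rewrite -[f _ (_ *: _)]/(frL _ _) linearZ scalerA.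
  by rewrite /tens !mxE big_ord1 !mxE.
by exists gL => // g' g'E; apply: tlin_ext => a b; rewrite g'E gE.
Qed.

End Tensor.

(* Main.v *)
Require Import Defs.
From mathcomp Require Import all_boot all_order all_algebra all_field.
From mathcomp Require Import zify.

Import GRing.Theory.
Local Open Scope ring_scope.

(** The products [e_A (x) e_B] span [F] and commute up to the sign
    [(-1)^(|A||C| + |B||D|)], so a commutator of two of them is 0 or twice their
    product, and a nonzero long commutator is, up to a nonzero scalar, again
    such a product.  If [(a, b)] are the degrees of a partial commutator and
    [(c, d)] those of the next factor, the factor contributes only if
    [ac + bd] is odd.  Hence [(a, b)] must not be (even, even) before the last
    step, is never (odd, odd) after the first one, and every intermediate step
    beyond the second raises both degrees.  With the parities this forces a
    degree at least [m] in a nonzero commutator of even length [m]; for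
    [m = 2k + 2] this exceeds the number of generators.  Conversely
    [[e_0 (x) 1, e_1 (x) e_0, ..., e_(2k-1) (x) e_(2k-2), 1 (x) e_(2k-1)]]
    is nonzero. *)

(** Elements of disjoint sets differ, so each pair is an inversion in exactly one of the two
    orders. *)
Lemma inversionsC (n : nat) (A B : {set 'I_n}) : [disjoint A & B] ->
  (inversions A B + inversions B A = #|A| * #|B|)%N.
Proof.
move=> dAB; rewrite /inversions [X in (_ + X)%N]exchange_big -big_split /=.
rewrite -sum_nat_const; apply: eq_bigr => i iA.
rewrite -big_split /= -sum1_card.
apply: eq_bigr => j jB.
have /eqP : i != j by apply: contraTneq jB => <-; rewrite (disjointFr dAB).
by move=> neij; have := neij \o @val_inj _ _ _ i j => /=; lia.
Qed.

Lemma gcoefC (K : fieldType) (n : nat) (A B : {set 'I_n}) :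
  gcoef K B A = (-1) ^+ (#|A| * #|B|) * gcoef K A B.
Proof.
rewrite /gcoef disjoint_sym; case: ifP => [dAB|]; last by rewrite mulr0.
rewrite -exprD -inversionsC // addnAC addnn exprD.
by rewrite -mul2n exprM sqrrN !expr1n mul1r.
Qed.

Lemma gcoef_neq0 (K : fieldType) (n : nat) (A B : {set 'I_n}) :
  (gcoef K A B != 0) = [disjoint A & B].
Proof. by rewrite /gcoef; case: ifP => _; rewrite ?signr_eq0 ?eqxx. Qed.

Lemma gbasis_neq0 (K : fieldType) (n : nat) (A : {set 'I_n}) : gbasis K A != 0.
Proof.
by apply/eqP=> /ffunP/(_ A)/eqP; rewrite !ffunE eqxx oner_eq0.
Qed.

Lemma card_ord_lt (n m : nat) :
  (m <= n)%N -> #|[set i : 'I_n | (i < m)%N]| = m.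
Proof.
move=> le_mn; rewrite -sum1_card (eq_bigl (fun i : 'I_n => i < m)%N) => [|i].
  by rewrite (big_ord_narrow le_mn) sum1_card card_ord.
by rewrite inE.
Qed.

Lemma card_ord_eq (n m : nat) : #|[set i : 'I_n | i == m :> nat]| = (m < n)%N.
Proof.
case: (ltnP m n) => [lt_mn | le_nm].
  by apply/eqP/cards1P; exists (Ordinal lt_mn); apply/setP=> i; rewrite !inE.
by apply: eq_card0 => i; rewrite inE ltn_eqF ?(leq_trans (ltn_ord i)).
Qed.

Lemma lcomm_rcons (R : pzRingType) (u : seq R) (x : R) :
  u != [::] -> lcomm (rcons u x) = commutator (lcomm u) x.
Proof. by case: u => // y u _; rewrite /= foldl_rcons. Qed.

Section LongCommutators.
Variables (K : fieldType) (r s : nat).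
Local Notation F := (tensor (grassmann K r) (grassmann K s)).
Implicit Types (A C : {set 'I_r}) (B D : {set 'I_s}) (x y : F).

Definition tgbasis A B : F := tens (gbasis K A) (gbasis K B).

Lemma commutator_tgbasis A B C D :
  @commutator F (tgbasis A B) (tgbasis C D) =
    ((1 - (-1) ^+ (#|A| * #|C| + #|B| * #|D|)) * (gcoef K A C * gcoef K B D))
      *: tgbasis (A :|: C) (B :|: D).
Proof.
rewrite /commutator /tgbasis !tensM !gbasisM !tensZl !tensZr !scalerA.
rewrite [C :|: A]setUC [D :|: B]setUC -scalerBl; congr (_ *: _).
by rewrite (gcoefC K _ A) (gcoefC K s B) mulrBl mul1r exprD mulrACA.
Qed.

(* The degrees (a, b) possible in a nonzero long commutator of length m. *)
Definition degree_ok (m a b : nat) : bool :=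
  if odd a || odd b then [&& m.-1 <= a, m.-1 <= b & odd (a + b) || (m <= 1)]%N
  else [|| odd m, m <= a | m <= b]%N.

Lemma degree_ok1 a b : degree_ok 1 a b.
Proof. by rewrite /degree_ok orbT; case: ifP. Qed.

(** Oddness of [a * c + b * d] makes [a] or [b] odd. If both new degrees are even and [m] is odd,
    the odd one of [a] and [b] exceeds the even bound [m.-1], and its odd increment lifts it to at
    least [m.+1]. *)
Lemma degree_okS m a b c d : (0 < m)%N -> odd (a * c + b * d) ->
  degree_ok m a b -> degree_ok m.+1 (a + c) (b + d).
Proof.
rewrite /degree_ok !oddD !oddM /= => m_gt0.
case ea: (odd a); case eb: (odd b); case ec: (odd c); case ed: (odd d) => //=;
  lia.
Qed.

(** With an odd degree, both would equal [m.-1], so their sum would be even. *)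
Lemma degree_ok_max m a b : ~~ odd m -> (a < m)%N -> (b < m)%N ->
  degree_ok m a b = false.
Proof. rewrite /degree_ok; case ea: (odd a); case eb: (odd b) => //=; lia. Qed.

Definition tspan (m : nat) : {vspace F} :=
  (\sum_(p : {set 'I_r} * {set 'I_s} | degree_ok m #|p.1| #|p.2|)
     <[tgbasis p.1 p.2]>)%VS.

Lemma mem_tspan m A B : degree_ok m #|A| #|B| -> tgbasis A B \in tspan m.
Proof.
move=> ok; apply: (subvP (sumv_sup (A, B) ok (subvv _))).
exact: memv_line.
Qed.

Lemma tspan_ind m (P : F -> Prop) :
  (forall x y, P x -> P y -> P (x + y)) -> (forall a x, P x -> P (a *: x)) ->
  P 0 -> (forall A B, degree_ok m #|A| #|B| -> P (tgbasis A B)) ->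
  forall x, x \in tspan m -> P x.
Proof.
move=> PD PZ P0 Pb x /memv_sumP[v v_in ->].
apply: (big_ind P) => // p ok.
by have /vlineP[a ->] := v_in p ok; apply/PZ/Pb.
Qed.

Lemma tspan1 x : x \in tspan 1.
Proof.
rewrite [x]tens_sum; apply: rpred_sum => i _; apply: rpred_sum => j _.
apply: rpredZ; rewrite [tbase i]gbasis_sum [tbase j]gbasis_sum tens_suml.
apply: rpred_sum => A _; rewrite tens_sumr; apply: rpred_sum => B _.
by rewrite tensZl tensZr !rpredZ // mem_tspan ?degree_ok1.
Qed.

Lemma commutator_tspan m x y : (0 < m)%N ->
  x \in tspan m -> @commutator F x y \in tspan m.+1.
Proof.
move=> m_gt0; elim/tspan_ind: x / => [x1 x2 IH1 IH2|a x IH||A B ok].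
- rewrite /commutator mulrDl mulrDr opprD addrACA.
  exact: rpredD.
- by rewrite /commutator -scalerAl -scalerAr -scalerBr rpredZ.
- by rewrite /commutator mul0r mulr0 subrr rpred0.
(* [tspan 1] is all of [F], so linearity reduces [y] to basis products too. *)
elim/(@tspan_ind 1): y / (tspan1 y) => [y1 y2 IH1 IH2|a y IH||C D _].
- rewrite /commutator mulrDl mulrDr opprD addrACA.
  exact: rpredD.
- by rewrite /commutator -scalerAl -scalerAr -scalerBr rpredZ.
- by rewrite /commutator mul0r mulr0 subrr rpred0.
rewrite commutator_tgbasis.
case odd_deg: (odd (#|A| * #|C| + #|B| * #|D|)); last first.
  by rewrite -signr_odd odd_deg subrr mul0r scale0r rpred0.
case dAC: [disjoint A & C]; last first.
  by rewrite /gcoef dAC mul0r mulr0 scale0r rpred0.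
case dBD: [disjoint B & D]; last first.
  by rewrite /gcoef dBD !mulr0 scale0r rpred0.
apply/rpredZ/mem_tspan.
rewrite !cardsU (disjoint_setI0 dAC) (disjoint_setI0 dBD).
by rewrite !cards0 !subn0; apply: degree_okS.
Qed.

Lemma lcomm_tspan (u : seq F) : u != [::] -> @lcomm F u \in tspan (size u).
Proof.
elim/last_ind: u => // -[|x u] y IHu _; first exact: tspan1.
by rewrite lcomm_rcons // size_rcons commutator_tspan // IHu.
Qed.

Lemma sat_lcomm_even m : (0 < m)%N -> ~~ odd m -> (r < m)%N -> (s < m)%N ->
  sat_lcomm F m.
Proof.
move=> m_gt0 m_even lt_rm lt_sm u.
have: @lcomm F u \in tspan m.
  by rewrite -{2}(size_tuple u) lcomm_tspan // -size_eq0 size_tuple -lt0n.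
(* No degrees bounded by [r] and [s] are admissible: the span is an empty sum. *)
rewrite /tspan big1 => [|p]; first by rewrite memv0 => /eqP.
have le_card n (A : {set 'I_n}) : (#|A| <= n)%N.
  by have := max_card A; rewrite card_ord.
by rewrite degree_ok_max // (leq_ltn_trans (le_card _ _)).
Qed.

(** The left set is empty for [n = 2 * k], the right one for [n = 0]; these give the end factors
    with a tensor component 1. *)
Definition witness (k n : nat) : F :=
  tgbasis [set i : 'I_r | (i == n :> nat) && (n < 2 * k)%N]
    [set j : 'I_s | j.+1 == n].

(** Adding factor [n.+1] gives the sign exponent [n.+1 + n], or just [n = 2 * k - 1] at the last
    step. Both are odd, so each step contributes a factor 2 up to sign. *)
Lemma lcomm_witness k n : 2%N \notin [pchar K] ->
    (2 * k <= r)%N -> (2 * k <= s)%N -> (n <= 2 * k)%N ->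
  exists2 c : K, c != 0 &
    @lcomm F [seq witness k i | i <- iota 0 n.+1] =
      c *: tgbasis [set i : 'I_r | (i < minn n.+1 (2 * k))%N]
                   [set j : 'I_s | (j < n)%N].
Proof.
move=> charK le_r le_s; elim: n => [|n IHn] le_n.
  exists 1; first exact: oner_neq0.
  rewrite scale1r /=; congr tgbasis; apply/setP=> i; rewrite !inE //; lia.
have [|c c_neq0 IH] := IHn; first by lia.
rewrite -addn1 iotaD map_cat cats1 lcomm_rcons // IH /=.
rewrite /commutator -scalerAl -scalerAr -scalerBr -/(commutator _ _).
rewrite commutator_tgbasis scalerA.
eexists; last first.
  by congr (_ *: tgbasis _ _); apply/setP=> i; rewrite !inE; lia.
rewrite !mulf_neq0 // ?gcoef_neq0.
(* The out-of-range value [r] encodes the empty set, so [card_ord_eq] covers both cases. *)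
- have -> : [set i : 'I_r | (i == 0 + n.+1 :> nat)%N && (0 + n.+1 < 2 * k)%N] =
            [set i : 'I_r | i == (if n.+1 < 2 * k then n.+1 else r) :> nat]%N.
    by apply/setP=> i; have := ltn_ord i; rewrite !inE; case: ifP => /=; lia.
  rewrite !card_ord_lt ?card_ord_eq; [|lia..].
  rewrite -signr_odd (_ : odd _ = true) ?expr1; last first.
    by case: (ltnP n.+1 (2 * k)) => lt_n; lia.
  by rewrite opprK -mulr2n; rewrite !inE in charK.
- by rewrite -setI_eq0; apply/eqP/setP=> i; rewrite !inE; lia.
- by rewrite -setI_eq0; apply/eqP/setP=> i; rewrite !inE; lia.
Qed.

End LongCommutators.

Theorem proposition2p9 (K : fieldType) (charK : 2%N \notin [pchar K])
    (k : nat) (k_ge1 : (1 <= k)%N) (r s : nat)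
    (rs : (r, s) \in [:: (2 * k, 2 * k); (2 * k + 1, 2 * k + 1);
                         (2 * k, 2 * k + 1); (2 * k + 1, 2 * k)]%N) :
  let F := tensor (grassmann K r) (grassmann K s) in
  sat_lcomm F (2 * k + 2) /\ ~ sat_lcomm F (2 * k + 1).
Proof.
have [/andP[ge_r le_r] /andP[ge_s le_s]] :
    (2 * k <= r <= 2 * k + 1)%N /\ (2 * k <= s <= 2 * k + 1)%N.
  by move: rs; rewrite !inE !xpair_eqE; lia.
split; first by apply: sat_lcomm_even; lia.
have [c c_neq0 cE] := lcomm_witness K r s k (2 * k) charK ge_r ge_s (leqnn _).
move/(_ (tcast (esym (addn1 _)) [tuple of
  [seq witness K r s k i | i <- iota 0 (2 * k).+1]])).
rewrite val_tcast => /(etrans (esym cE))/eqP.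
by rewrite scaler_eq0 (negPf c_neq0) tens_eq0 !(negPf (gbasis_neq0 _ _ _)).
Qed.
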